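(* Let $H=(H,\Delta,\varepsilon,m,\mu)$ be a unital associative counital coassociative bialgebra over a field $k$. Then the following statements are equivalent: (1) $H$ is a Hopf algebra, i.e. there is a linear map $S:H\to H$ with $\sum S(h_{(1)})h_{(2)}=\sum h_{(1)}S(h_{(2)})=\varepsilon(h)1$ for all $h\in H$; (2) there is a linear map $S:H\to H$ such that $S$ and $\mathrm{id}_H$ are inverse to each other in the convolution algebra $H*H=\mathrm{Hom}(H,H)$; (3) the linear map $T_1:H\otimes H\to H\otimes H$, $T_1(x\otimes y)=\Delta(x)(1\otimes y)$, is bijective, and moreover $T_1^{-1}$ is a right $H$-module map and a left $H$-comodule map; (4) the linear map $T_2:H\otimes H\to H\otimes H$, $T_2(x\otimes y)=(x\otimes 1)\Delta(y)$, is bijective, and moreover $T_2^{-1}$ is a left $H$-module map and a right $H$-comodule map; (5) the element $L\in\mathrm{Hom}(H,\mathrm{End}(H))$, $L(a)=L_a$ with $L_a(x)=ax$, is invertible in the convolution algebra $H*\mathrm{End}(H)$; (6) the element $R\in\mathrm{Hom}(H,\mathrm{End}(H))$, $R(a)=R_a$ with $R_a(x)=xa$, is invertible in the convolution algebra $H*\mathrm{End}(H)$.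
   Context: All vector spaces are over a field $k$; $\Delta(x)=\sum x_{(1)}\otimes x_{(2)}$ is Sweedler notation and $\mathrm{End}(H)$ denotes the algebra of $k$-linear endomorphisms of $H$ under composition. A unital counital bialgebra has a product with unit $1=\mu(1_k)$ and a coproduct with counit such that $\Delta(xy)=\Delta(x)\Delta(y)$, $\varepsilon(xy)=\varepsilon(x)\varepsilon(y)$, $\Delta(1)=1\otimes 1$, $\varepsilon(1)=1$. Convolution: for a counital coalgebra $C$ and a unital algebra $A$, $C*A$ denotes the vector space $\mathrm{Hom}(C,A)$ of linear maps with product $(f*g)(x)=\sum f(x_{(1)})g(x_{(2)})$ and unit $x\mapsto\varepsilon(x)1_A$. In particular, $H*\mathrm{End}(H)$ has unit $a\mapsto\varepsilon(a)\mathrm{id}_H$. Module structures on $H\otimes H$: left action $a(x\otimes y)=ax\otimes y$ and right action $(x\otimes y)a=x\otimes ya$. Comodule structures on $H\otimes H$: left coaction $\rho^l(x\otimes y)=\sum x_{(1)}\otimes(x_{(2)}\otimes y)$ and right coaction $\rho^r(x\otimes y)=\sum(x\otimes y_{(1)})\otimes y_{(2)}$.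
   Formalization: In (6), R is taken in H*End(H)^op (composition reversed: first R_a, then R_b) instead of H*End(H); with ordinary composition (6) characterizes a skew antipode, so it fails for Hopf algebras with non-bijective antipode. *)

(* Defs.v *)
From HB Require Import structures.
From mathcomp Require Import all_boot all_algebra.
From mathcomp Require Import sesquilinear ring_quotient generic_quotient.
From mathcomp Require Import boolp freeg.

Set Implicit Arguments.
Unset Strict Implicit.
Unset Printing Implicit Defensive.

Import GRing.Theory.
Local Open Scope ring_scope.

Reserved Notation "U \ox V" (at level 40, left associativity).
Reserved Notation "u \ot v" (at level 40, left associativity).

(* MathComp has no tensor product of arbitrary (possibly infinite-dimensional)
   spaces, so U \ox V is built in the usual way: the free k-vector space on
   U * V modulo the subspace spanned by the bilinearity relations. *)
Section TensorConstruction.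
Context (k : fieldType) (U V : lmodType k).

Local Notation free := {freeg (U * V) / k}.
Local Notation pt u v := (<< (u, v) >> : free).

Inductive bilin_span : free -> Prop :=
| bilin_addl u u' v : bilin_span (pt (u + u') v - pt u v - pt u' v)
| bilin_addr u v v' : bilin_span (pt u (v + v') - pt u v - pt u v')
| bilin_scalel a u v : bilin_span (pt (a *: u) v - a *: pt u v)
| bilin_scaler a u v : bilin_span (pt u (a *: v) - a *: pt u v)
| bilin_span0 : bilin_span 0
| bilin_spanD x y : bilin_span x -> bilin_span y -> bilin_span (x + y)
| bilin_spanZ a x : bilin_span x -> bilin_span (a *: x).

Definition bilin_pred : {pred free} := fun x => `[< bilin_span x >].

Lemma bilin_predP x : reflect (bilin_span x) (x \in bilin_pred).
Proof. exact: asboolP. Qed.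

Lemma bilin_pred_closed : zmod_closed bilin_pred.
Proof.
split=> [|x y /bilin_predP xI /bilin_predP yI]; apply/bilin_predP.
  exact: bilin_span0.
by apply: bilin_spanD => //; rewrite -scaleN1r; apply: bilin_spanZ.
Qed.

HB.instance Definition _ :=
  GRing.isZmodClosed.Build free bilin_pred bilin_pred_closed.

Definition tens : Type := Quotient.quot bilin_pred.

HB.instance Definition _ := GRing.Zmodule.on tens.

Definition tens_pi (x : free) : tens := (\pi_(Quotient.quot bilin_pred) x)%qT.

Lemma tens_piB : {morph tens_pi : x y / x - y}.
Proof. by move=> x y; rewrite /tens_pi raddfB. Qed.

Lemma tens_pi0 : tens_pi 0 = 0. Proof. by rewrite -(subrr 0) tens_piB subrr. Qed.

Lemma tens_piD : {morph tens_pi : x y / x + y}.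
Proof. by move=> x y; rewrite /tens_pi raddfD. Qed.

Lemma tens_pi_eq x y : tens_pi x = tens_pi y <-> bilin_span (x - y).
Proof.
split=> [e|/bilin_predP]; last by rewrite Quotient.idealrBE => /eqP.
by apply/bilin_predP; rewrite Quotient.idealrBE; apply/eqP.
Qed.

Lemma tens_repr (t : tens) : exists x, t = tens_pi x.
Proof. by exists (repr (t : Quotient.quot bilin_pred)); rewrite /tens_pi reprK. Qed.

Definition tens_scale (a : k) (t : tens) : tens :=
  tens_pi (a *: repr (t : Quotient.quot bilin_pred)).

Lemma tens_piZ a x : tens_scale a (tens_pi x) = tens_pi (a *: x).
Proof.
apply/tens_pi_eq; rewrite -scalerBr; apply: bilin_spanZ.
by apply/tens_pi_eq; rewrite /tens_pi reprK.
Qed.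

Fact tens_scaleA a b t : tens_scale a (tens_scale b t) = tens_scale (a * b) t.
Proof. by have [x ->] := tens_repr t; rewrite !tens_piZ scalerA. Qed.

Fact tens_scale1 : left_id 1 tens_scale.
Proof. by move=> t; have [x ->] := tens_repr t; rewrite tens_piZ scale1r. Qed.

Fact tens_scaleDr : right_distributive tens_scale +%R.
Proof.
move=> a s t; have [x ->] := tens_repr s; have [y ->] := tens_repr t.
by rewrite -tens_piD !tens_piZ -tens_piD scalerDr.
Qed.

Fact tens_scaleDl t : {morph tens_scale^~ t : a b / a + b}.
Proof.
move=> a b; have [x ->] := tens_repr t.
by rewrite !tens_piZ -tens_piD scalerDl.
Qed.

HB.instance Definition _ := GRing.Zmodule_isLmodule.Build k tens
  tens_scaleA tens_scale1 tens_scaleDr tens_scaleDl.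

Definition ptens (u : U) (v : V) : tens := tens_pi (pt u v).

Fact ptens_bilinear : bilinear_for ( *:%R) ( *:%R) ptens.
Proof.
split=> [v a u u'|u a v v']; rewrite /ptens.
  transitivity (tens_pi (pt (a *: u) v + pt u' v)).
    by apply/tens_pi_eq; rewrite opprD addrA; apply: bilin_addl.
  rewrite tens_piD; congr (_ + _); rewrite [RHS]tens_piZ.
  by apply/tens_pi_eq; apply: bilin_scalel.
transitivity (tens_pi (pt u (a *: v) + pt u v')).
  by apply/tens_pi_eq; rewrite opprD addrA; apply: bilin_addr.
rewrite tens_piD; congr (_ + _); rewrite [RHS]tens_piZ.
by apply/tens_pi_eq; apply: bilin_scaler.
Qed.

HB.instance Definition _ :=
  bilinear_isBilinear.Build k U V tens _ _ ptens ptens_bilinear.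

Lemma tens_ind (P : tens -> Prop) :
    (forall u v, P (ptens u v)) -> P 0 ->
    (forall s t, P s -> P t -> P (s + t)) ->
    (forall a t, P t -> P (a *: t)) ->
  forall t, P t.
Proof.
move=> Pp P0 PD PZ t; have [x ->] := tens_repr t.
rewrite -[x]freeg_sumE; elim/big_ind: _ => [|y z|[u v] _].
- by rewrite tens_pi0.
- by rewrite tens_piD; apply: PD.
suff -> : << coeff (u, v) x *g (u, v) >> = coeff (u, v) x *: pt u v.
  by rewrite -tens_piZ; apply/PZ/Pp.
apply/eqP/freeg_eqP => w; rewrite coeffZ !coeffU.
by rewrite mul1r.
Qed.

Section Lift.
Context (W : lmodType k) (f : {bilinear U -> V -> W}).

Definition flift (x : free) : W := fglift (fun p => f p.1 p.2) x.

Fact flift_zmod : zmod_morphism flift. Proof. exact: lift_is_additive. Qed.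
HB.instance Definition _ := GRing.isZmodMorphism.Build free W flift flift_zmod.

Lemma flift_pt u v : flift (pt u v) = f u v.
Proof. by rewrite /flift liftU scale1r. Qed.

Lemma fliftZ a x : flift (a *: x) = a *: flift x.
Proof.
rewrite -[x]freeg_sumE; elim/big_ind: _ => [|y z Ey Ez|p _].
- by rewrite scaler0 raddf0 scaler0.
- by rewrite scalerDr !raddfD /= Ey Ez.
have -> : a *: << coeff p x *g p >> = << a * coeff p x *g p >> :> free.
  by apply/eqP/freeg_eqP => w; rewrite coeffZ !coeffU mulrA.
by rewrite /flift !liftU scalerA.
Qed.

Lemma flift_span x : bilin_span x -> flift x = 0.
Proof.
elim=> {x} [u u' v|u v v'|a u v|a u v||x y _ + _|a x _].
- by rewrite !raddfB /= !flift_pt linearDl addrAC addrK subrr.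
- by rewrite !raddfB /= !flift_pt linearDr addrAC addrK subrr.
- by rewrite raddfB /= fliftZ !flift_pt linearZl_LR subrr.
- by rewrite raddfB /= fliftZ !flift_pt linearZr_LR subrr.
- exact: raddf0.
- by rewrite raddfD /= => -> ->; rewrite addr0.
- by rewrite fliftZ => ->; rewrite scaler0.
Qed.

Definition tlift (t : tens) : W := flift (repr (t : Quotient.quot bilin_pred)).

Lemma tlift_pi x : tlift (tens_pi x) = flift x.
Proof.
apply/eqP; rewrite -subr_eq0 -raddfB; apply/eqP/flift_span.
by apply/tens_pi_eq; rewrite /tens_pi reprK.
Qed.

Fact tlift_linear : linear tlift.
Proof.
move=> a s t; have [x ->] := tens_repr s; have [y ->] := tens_repr t.
by rewrite [a *: _]tens_piZ -tens_piD !tlift_pi raddfD /= fliftZ.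
Qed.

HB.instance Definition _ := GRing.isLinear.Build k tens W _ tlift tlift_linear.

Lemma tliftE u v : tlift (ptens u v) = f u v.
Proof. by rewrite tlift_pi flift_pt. Qed.

End Lift.

Lemma tens_ext (W : lmodType k) (f g : {linear tens -> W}) :
  (forall u v, f (ptens u v) = g (ptens u v)) -> f =1 g.
Proof.
move=> fg; elim/tens_ind=> [//||s t Es Et|a t Et].
- by rewrite !linear0.
- by rewrite !linearD Es Et.
- by rewrite !linearZ Et.
Qed.

End TensorConstruction.

Notation "U \ox V" := (tens U V).
Notation "u \ot v" := (ptens u v) : ring_scope.

Section TensorMaps.
Context (k : fieldType).

Lemma ptensPl (U V : lmodType k) a (u u' : U) (v : V) :
  (a *: u + u') \ot v = a *: (u \ot v) + u' \ot v.
Proof. exact: linearPl. Qed.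

Lemma ptensPr (U V : lmodType k) a (u : U) (v v' : V) :
  u \ot (a *: v + v') = a *: (u \ot v) + u \ot v'.
Proof. exact: linearPr. Qed.

Implicit Types U V W : lmodType k.

Section Map.
Context (U U' V V' : lmodType k) (f : {linear U -> U'}) (g : {linear V -> V'}).

Definition tmap_fun (u : U) (v : V) : U' \ox V' := f u \ot g v.

Fact tmap_fun_bilinear : bilinear_for *:%R *:%R tmap_fun.
Proof.
by split=> [v a u u'|u a v v']; rewrite /tmap_fun linearP (ptensPl, ptensPr).
Qed.

HB.instance Definition _ :=
  bilinear_isBilinear.Build k U V (U' \ox V') _ _ tmap_fun tmap_fun_bilinear.

Definition tmap : {linear U \ox V -> U' \ox V'} := tlift tmap_fun.

Lemma tmapE u v : tmap (u \ot v) = f u \ot g v.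
Proof. exact: tliftE. Qed.

End Map.


Section Assoc.
Context (U V W : lmodType k).

Definition tassoc_pure (w : W) (u : U) (v : V) : U \ox (V \ox W) :=
  u \ot (v \ot w).

Fact tassoc_pure_bilinear w : bilinear_for *:%R *:%R (tassoc_pure w).
Proof.
split=> [v a u u'|u a v v']; rewrite /tassoc_pure; first exact: ptensPl.
by rewrite ptensPl ptensPr.
Qed.

HB.instance Definition _ w := bilinear_isBilinear.Build k U V
  (U \ox (V \ox W)) _ _ (tassoc_pure w) (tassoc_pure_bilinear w).

Definition tassoc_fun (t : U \ox V) (w : W) := tlift (tassoc_pure w) t.

Fact tassoc_fun_bilinear : bilinear_for *:%R *:%R tassoc_fun.
Proof.
split=> [w a s t|t a w w']; rewrite /tassoc_fun ?linearP //.
elim/tens_ind: t => [u v||s t Es Et|b t Et]; rewrite ?tliftE /=.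
- by rewrite /tassoc_pure !ptensPr.
- by rewrite !linear0 addr0.
- by rewrite !linearD /= Es Et addrACA.
- by rewrite !linearZ /= Et scalerDr !scalerA mulrC.
Qed.

HB.instance Definition _ := bilinear_isBilinear.Build k (U \ox V) W
  (U \ox (V \ox W)) _ _ tassoc_fun tassoc_fun_bilinear.

Definition tassoc : {linear (U \ox V) \ox W -> U \ox (V \ox W)} :=
  tlift tassoc_fun.

Lemma tassocE u v w : tassoc ((u \ot v) \ot w) = u \ot (v \ot w).
Proof.
by transitivity (tassoc_fun (u \ot v) w); [exact: tliftE | exact: tliftE].
Qed.

Definition tassocV_pure (u : U) (v : V) (w : W) : (U \ox V) \ox W :=
  (u \ot v) \ot w.

Fact tassocV_pure_bilinear u : bilinear_for *:%R *:%R (tassocV_pure u).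
Proof.
split=> [w a v v'|v a w w']; rewrite /tassocV_pure; last exact: ptensPr.
by rewrite ptensPr ptensPl.
Qed.

HB.instance Definition _ u := bilinear_isBilinear.Build k V W
  ((U \ox V) \ox W) _ _ (tassocV_pure u) (tassocV_pure_bilinear u).

Definition tassocV_fun (u : U) (t : V \ox W) := tlift (tassocV_pure u) t.

Fact tassocV_fun_bilinear : bilinear_for *:%R *:%R tassocV_fun.
Proof.
split=> [t a u u'|u a s t]; rewrite /tassocV_fun ?linearP //.
elim/tens_ind: t => [v w||s t Es Et|b t Et]; rewrite ?tliftE /=.
- by rewrite /tassocV_pure !ptensPl.
- by rewrite !linear0 addr0.
- by rewrite !linearD /= Es Et addrACA.
- by rewrite !linearZ /= Et scalerDr !scalerA mulrC.
Qed.

HB.instance Definition _ := bilinear_isBilinear.Build k U (V \ox W)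
  ((U \ox V) \ox W) _ _ tassocV_fun tassocV_fun_bilinear.

Definition tassocV : {linear U \ox (V \ox W) -> (U \ox V) \ox W} :=
  tlift tassocV_fun.

Lemma tassocVE u v w : tassocV (u \ot (v \ot w)) = (u \ot v) \ot w.
Proof.
by transitivity (tassocV_fun u (v \ot w)); [exact: tliftE | exact: tliftE].
Qed.

End Assoc.

Section Unitors.
Context (U : lmodType k).

Definition tunitl_fun (a : k^o) (u : U) : U := a *: u.

Fact tunitl_fun_bilinear : bilinear_for *:%R *:%R tunitl_fun.
Proof.
split=> [u a b c|b a u v]; rewrite /tunitl_fun /=.
  by rewrite scalerDl scalerA.
by rewrite scalerDr !scalerA mulrC.
Qed.

HB.instance Definition _ :=
  bilinear_isBilinear.Build k k^o U U _ _ tunitl_fun tunitl_fun_bilinear.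

Definition tunitl : {linear k^o \ox U -> U} := tlift tunitl_fun.

Lemma tunitlE a u : tunitl (a \ot u) = a *: u.
Proof. exact: tliftE. Qed.

Definition tunitr_fun (u : U) (a : k^o) : U := a *: u.

Fact tunitr_fun_bilinear : bilinear_for *:%R *:%R tunitr_fun.
Proof.
by split=> [b a u v|u a b c]; case: tunitl_fun_bilinear => l r; rewrite [LHS](l, r).
Qed.

HB.instance Definition _ :=
  bilinear_isBilinear.Build k U k^o U _ _ tunitr_fun tunitr_fun_bilinear.

Definition tunitr : {linear U \ox k^o -> U} := tlift tunitr_fun.

Lemma tunitrE u a : tunitr (u \ot a) = a *: u.
Proof. exact: tliftE. Qed.

End Unitors.

End TensorMaps.

Arguments tmap : simpl never.
Arguments tassoc : simpl never.
Arguments tassocV : simpl never.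
Arguments tunitl : simpl never.
Arguments tunitr : simpl never.

Section Algebras.
Context (k : fieldType).

Section Mul.
Context (A : algType k).

Definition lmul (a x : A) : A := a * x.
Definition rmul (a x : A) : A := x * a.

Fact lmul_linear a : linear (lmul a).
Proof. by move=> b x y; rewrite /lmul mulrDr scalerAr. Qed.
Fact rmul_linear a : linear (rmul a).
Proof. by move=> b x y; rewrite /rmul mulrDl scalerAl. Qed.

HB.instance Definition _ a :=
  GRing.isLinear.Build k A A _ (lmul a) (lmul_linear a).
HB.instance Definition _ a :=
  GRing.isLinear.Build k A A _ (rmul a) (rmul_linear a).

Fact lmul_bilinear : bilinear_for *:%R *:%R lmul.
Proof.
split=> [x a y z|x a y z] /=; last exact: linearP.
by rewrite /lmul mulrDl scalerAl.
Qed.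

HB.instance Definition _ :=
  bilinear_isBilinear.Build k A A A _ _ lmul lmul_bilinear.

Definition mulmap : {linear A \ox A -> A} := tlift lmul.

Lemma mulmapE x y : mulmap (x \ot y) = x * y.
Proof. exact: tliftE. Qed.

End Mul.

(* The algebra A \ox B, with (a (x) b)(c (x) d) = ac (x) bd. *)
Section TensorAlgebra.
Context (A B : algType k).

Definition tmul_pure (t : A \ox B) (a : A) (b : B) : A \ox B :=
  tmap (lmul a) (lmul b) t.

Fact tmul_pure_bilinear t : bilinear_for *:%R *:%R (tmul_pure t).
Proof.
rewrite /tmul_pure; split=> [b a x y|x a b c].
all: elim/tens_ind: t => [u v||s t Es Et|d t Et]; rewrite ?tmapE /=.
all: try by rewrite !linear0 addr0.
all: try by rewrite !linearD /= Es Et addrACA.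
all: try by rewrite !linearZ /= Et scalerDr !scalerA mulrC.
- by rewrite /lmul mulrDl -scalerAl ptensPl.
- by rewrite /lmul mulrDl -scalerAl ptensPr.
Qed.

HB.instance Definition _ t := bilinear_isBilinear.Build k A B (A \ox B) _ _
  (tmul_pure t) (tmul_pure_bilinear t).

Definition tmul (s t : A \ox B) : A \ox B := tlift (tmul_pure t) s.

Fact tmulE a b c d : tmul (a \ot b) (c \ot d) = (a * c) \ot (b * d).
Proof.
by transitivity (tmul_pure (c \ot d) a b); [exact: tliftE | exact: tmapE].
Qed.

Fact tmulPl t : linear (tmul^~ t).
Proof. by move=> a x y; rewrite /tmul linearP. Qed.

Fact tmulPr s : linear (tmul s).
Proof.
move=> a x y; rewrite /tmul.
elim/tens_ind: s => [u v||s t Es Et|d t Et]; rewrite ?tliftE /=.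
- by rewrite /tmul_pure linearP.
- by rewrite !linear0 addr0.
- by rewrite !linearD /= Es Et addrACA.
- by rewrite !linearZ /= Et scalerDr !scalerA mulrC.
Qed.

Fact tmulDl : left_distributive tmul +%R.
Proof. by move=> s t u; have := tmulPl u 1 s t; rewrite /= !scale1r. Qed.
Fact tmulDr : right_distributive tmul +%R.
Proof. by move=> s t u; have := tmulPr s 1 t u; rewrite !scale1r. Qed.
Fact tmul0l : left_zero 0 tmul.
Proof. by move=> t; rewrite /tmul linear0. Qed.
Fact tmul0r : right_zero 0 tmul.
Proof.
move=> s; have := tmulPr s (-1) 0 0.
by rewrite !(scaler0, addr0) => ->; rewrite scaleN1r addNr.
Qed.
Fact tmulZl a s t : tmul (a *: s) t = a *: tmul s t.
Proof. by have := tmulPl t a s 0; rewrite /= tmul0l !addr0. Qed.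
Fact tmulZr a s t : tmul s (a *: t) = a *: tmul s t.
Proof. by have := tmulPr s a t 0; rewrite tmul0r !addr0. Qed.

Fact tmulA : associative tmul.
Proof.
move=> r s t; elim/tens_ind: r => [a b||x y Ex Ey|c x Ex].
- elim/tens_ind: s => [a' b'||x y Ex Ey|c x Ex].
  + elim/tens_ind: t => [a'' b''||x y Ex Ey|c x Ex].
    * by rewrite !tmulE !mulrA.
    * by rewrite !tmul0r.
    * by rewrite !tmulDr Ex Ey.
    * by rewrite !tmulZr Ex.
  + by rewrite !(tmul0r, tmul0l).
  + by rewrite !(tmulDl, tmulDr) Ex Ey.
  + by rewrite !(tmulZl, tmulZr) Ex.
- by rewrite !tmul0l.
- by rewrite !tmulDl Ex Ey.
- by rewrite !tmulZl Ex.
Qed.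

Fact tmul1l : left_id (1 \ot 1) tmul.
Proof.
elim/tens_ind=> [a b||x y Ex Ey|c x Ex].
- by rewrite tmulE !mul1r.
- exact: tmul0r.
- by rewrite tmulDr Ex Ey.
- by rewrite tmulZr Ex.
Qed.

Fact tmul1r : right_id (1 \ot 1) tmul.
Proof.
elim/tens_ind=> [a b||x y Ex Ey|c x Ex].
- by rewrite tmulE !mulr1.
- exact: tmul0l.
- by rewrite tmulDl Ex Ey.
- by rewrite tmulZl Ex.
Qed.

HB.instance Definition _ := GRing.Zmodule_isPzRing.Build (A \ox B)
  tmulA tmul1l tmul1r tmulDl tmulDr.

Lemma tens1 : 1 = 1 \ot 1 :> A \ox B. Proof. by []. Qed.

Lemma tensM (a c : A) (b d : B) : (a \ot b) * (c \ot d) = (a * c) \ot (b * d).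
Proof. exact: tmulE. Qed.

End TensorAlgebra.

End Algebras.

Arguments mulmap : simpl never.

Section ConverseAlgebra.
Context (k : fieldType) (A : algType k).

HB.instance Definition _ := GRing.Lmodule.copy A^c A.

Fact converse_scaleAl (a : k) (x y : A^c) : a *: (x * y) = (a *: x : A^c) * y.
Proof. exact: (@scalerAr k A a y x). Qed.
HB.instance Definition _ := GRing.Lmodule_isLalgebra.Build k A^c
  converse_scaleAl.

Fact converse_scaleAr (a : k) (x y : A^c) : a *: (x * y) = x * (a *: y : A^c).
Proof. exact: (@scalerAl k A a y x). Qed.
HB.instance Definition _ := GRing.Lalgebra_isAlgebra.Build k A^c
  converse_scaleAr.

Lemma converseME (x y : A^c : algType k) : x * y = (y : A) * (x : A).
Proof. by []. Qed.

End ConverseAlgebra.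

Lemma linear_eq (k : fieldType) (U V : lmodType k) (f g : {linear U -> V}) :
  f =1 g -> f = g.
Proof.
case: f g => [f [[h] [hm]]] [g [[j] [jm]]] /= /funext fg; subst g.
congr (GRing.Linear.Pack (GRing.Linear.Class _ _)); congr (_ _).
  exact: Prop_irrelevance.
exact: Prop_irrelevance.
Qed.

(* MathComp algebras are nonzero; A is required to be an algebra (rather than a
   vector space) only to ensure that the identity of A differs from 0. *)
Definition End (k : fieldType) (A : algType k) : Type := {linear A -> A}.

Section EndAlgebra.
Context (k : fieldType) (A : algType k).
Implicit Types f g h : End A.

HB.instance Definition _ := gen_eqMixin (End A).
HB.instance Definition _ := gen_choiceMixin (End A).

Definition end_zero : End A := (\0 : {linear A -> A}).
Definition end_opp f : End A :=
  (\- (f : {linear A -> A}) : {linear A -> A}).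
Definition end_add f g : End A :=
  ((f : {linear A -> A}) \+ (g : {linear A -> A}) : {linear A -> A}).
Definition end_scale a f : End A :=
  (a \*: (f : {linear A -> A}) : {linear A -> A}).
Definition end_one : End A := (idfun : {linear A -> A}).
Definition end_comp f g : End A :=
  ((f : {linear A -> A}) \o (g : {linear A -> A}) : {linear A -> A}).

Fact end_addA : associative end_add.
Proof. by move=> f g h; apply/linear_eq => x /=; rewrite addrA. Qed.
Fact end_addC : commutative end_add.
Proof. by move=> f g; apply/linear_eq => x /=; rewrite addrC. Qed.
Fact end_add0 : left_id end_zero end_add.
Proof. by move=> f; apply/linear_eq => x /=; rewrite add0r. Qed.
Fact end_addN : left_inverse end_zero end_opp end_add.
Proof. by move=> f; apply/linear_eq => x /=; rewrite addNr. Qed.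

HB.instance Definition _ := GRing.isZmodule.Build (End A)
  end_addA end_addC end_add0 end_addN.

Fact end_compA : associative end_comp.
Proof. by move=> f g h; apply/linear_eq. Qed.
Fact end_comp1l : left_id end_one end_comp.
Proof. by move=> f; apply/linear_eq. Qed.
Fact end_comp1r : right_id end_one end_comp.
Proof. by move=> f; apply/linear_eq. Qed.
Fact end_compDl : left_distributive end_comp +%R.
Proof. by move=> f g h; apply/linear_eq. Qed.
Fact end_compDr : right_distributive end_comp +%R.
Proof. by move=> f g h; apply/linear_eq => x /=; rewrite linearD. Qed.
Fact end_one_neq0 : end_one != 0.
Proof.
apply/eqP => /(congr1 (fun f : End A => f 1)) /= /eqP.
by apply/negP; exact: oner_neq0.
Qed.

HB.instance Definition _ := GRing.Zmodule_isNzRing.Build (End A)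
  end_compA end_comp1l end_comp1r end_compDl end_compDr end_one_neq0.

Fact end_scaleA a b f : end_scale a (end_scale b f) = end_scale (a * b) f.
Proof. by apply/linear_eq => x /=; rewrite scalerA. Qed.
Fact end_scale1 : left_id 1 end_scale.
Proof. by move=> f; apply/linear_eq => x /=; rewrite scale1r. Qed.
Fact end_scaleDr : right_distributive end_scale +%R.
Proof. by move=> a f g; apply/linear_eq => x /=; rewrite scalerDr. Qed.
Fact end_scaleDl f : {morph end_scale^~ f : a b / a + b}.
Proof. by move=> a b; apply/linear_eq => x /=; rewrite scalerDl. Qed.

HB.instance Definition _ := GRing.Zmodule_isLmodule.Build k (End A)
  end_scaleA end_scale1 end_scaleDr end_scaleDl.

Fact end_scaleAl a f g : a *: (f * g) = (a *: f) * g.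
Proof. exact/linear_eq. Qed.
Fact end_scaleAr a f g : a *: (f * g) = f * (a *: g).
Proof. by apply/linear_eq => x /=; rewrite linearZ. Qed.

HB.instance Definition _ := GRing.Lmodule_isLalgebra.Build k (End A) end_scaleAl.
HB.instance Definition _ := GRing.Lalgebra_isAlgebra.Build k (End A) end_scaleAr.

Lemma endME f g x : (f * g) x = f (g x). Proof. by []. Qed.
Lemma end1E x : (1 : End A) x = x. Proof. by []. Qed.
Lemma endZE a f x : (a *: f) x = a *: f x. Proof. by []. Qed.

End EndAlgebra.

Section Coalgebra.
Context (k : fieldType).

Record coalgebra (C : lmodType k)
    (Delta : {linear C -> C \ox C}) (eps : {linear C -> k^o}) : Prop :=
  Coalgebra {
    coassoc : forall x,
      tassoc _ _ _ (tmap Delta idfun (Delta x)) = tmap idfun Delta (Delta x);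
    counitl : forall x, tunitl _ (tmap eps idfun (Delta x)) = x;
    counitr : forall x, tunitr _ (tmap idfun eps (Delta x)) = x
  }.

(* H : algType k is associative, unital and nonzero; the latter is no restriction,
   as it follows from eps 1 = 1. *)
Record bialgebra (H : algType k)
    (Delta : {linear H -> H \ox H}) (eps : {linear H -> k^o}) : Prop :=
  Bialgebra {
    bialgebra_coalgebra : coalgebra Delta eps;
    comulM : {morph Delta : x y / x * y};
    comul1 : Delta 1 = 1 \ot 1;
    counitM : {morph eps : x y / x * y};
    counit1 : eps 1 = 1
  }.

Section Convolution.
Context (C : lmodType k).
Context (Delta : {linear C -> C \ox C}) (eps : {linear C -> k^o}).
Context (A : algType k).
Implicit Types f g : {linear C -> A}.

(* (f * g)(x) = sum f(x_1) g(x_2) *)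
Definition conv f g : {linear C -> A} := mulmap A \o tmap f g \o Delta.

Definition conv1_fun (x : C) : A := (eps x)%:A.

Fact conv1_linear : linear conv1_fun.
Proof. by move=> a x y; rewrite /conv1_fun linearP scalerDl -scalerA. Qed.

HB.instance Definition _ := GRing.isLinear.Build k C A _ conv1_fun conv1_linear.

Definition conv1 : {linear C -> A} := conv1_fun.

Definition conv_inverse f g : Prop := conv f g = conv1 /\ conv g f = conv1.

Definition conv_invertible f : Prop := exists g, conv_inverse f g.

End Convolution.
End Coalgebra.

Section Hopf.
Context (k : fieldType) (H : algType k).

Definition Lreg_fun (a : H) : End H := (lmul a : {linear H -> H}).

Fact Lreg_linear : linear Lreg_fun.
Proof.
move=> b x y; apply/linear_eq => z /=.
by rewrite /lmul mulrDl -scalerAl.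
Qed.

HB.instance Definition _ :=
  GRing.isLinear.Build k H (End H) _ Lreg_fun Lreg_linear.

Definition Lreg : {linear H -> End H} := Lreg_fun.

(* Right multiplications are operators written on the right of their argument:
   they are multiplied by R_a R_b = R_(ab), "first R_a, then R_b", which is the
   product of (End H)^c.  With the product of End H, invertibility of a |-> R_a
   characterises the existence of a skew antipode, a map T such that
   sum T(a_2) a_1 = sum a_2 T(a_1) = eps(a) 1, and not of an antipode. *)
Definition Rreg_fun (a : H) : (End H)^c := (rmul a : {linear H -> H}).

Fact Rreg_linear : linear Rreg_fun.
Proof.
move=> b x y; apply/linear_eq => z /=.
by rewrite /rmul mulrDr -scalerAr.
Qed.

HB.instance Definition _ :=
  GRing.isLinear.Build k H (End H)^c _ Rreg_fun Rreg_linear.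

Definition Rreg : {linear H -> (End H)^c} := Rreg_fun.

Lemma LregM a b : Lreg (a * b) = Lreg a * Lreg b.
Proof. by apply/linear_eq => x /=; rewrite /lmul mulrA. Qed.

Lemma RregM a b : Rreg (a * b) = Rreg a * Rreg b.
Proof. by apply/linear_eq => x /=; rewrite /rmul mulrA. Qed.

Definition lact (a : H) (t : H \ox H) : H \ox H := tmap (lmul a) idfun t.
Definition ract (t : H \ox H) (a : H) : H \ox H := tmap idfun (rmul a) t.

Definition lmodule_map (F : H \ox H -> H \ox H) : Prop :=
  forall a t, F (lact a t) = lact a (F t).
Definition rmodule_map (F : H \ox H -> H \ox H) : Prop :=
  forall t a, F (ract t a) = ract (F t) a.

Section Comodule.
Context (Delta : {linear H -> H \ox H}).

Definition lcoact : {linear H \ox H -> H \ox (H \ox H)} :=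
  tassoc H H H \o tmap Delta idfun.
Definition rcoact : {linear H \ox H -> (H \ox H) \ox H} :=
  tassocV H H H \o tmap idfun Delta.

Definition lcomodule_map (F : {linear H \ox H -> H \ox H}) : Prop :=
  forall t, lcoact (F t) = tmap idfun F (lcoact t).
Definition rcomodule_map (F : {linear H \ox H -> H \ox H}) : Prop :=
  forall t, rcoact (F t) = tmap F idfun (rcoact t).

(* T1 and T2 are the linear maps induced by the two bilinear maps below. *)
Definition galois1_fun (x y : H) : H \ox H := Delta x * (1 \ot y).
Definition galois2_fun (x y : H) : H \ox H := (x \ot 1) * Delta y.

Fact galois1_bilinear : bilinear_for *:%R *:%R galois1_fun.
Proof.
split=> [y a x x'|x a y y'] /=; rewrite /galois1_fun.
  by rewrite linearP; exact: tmulPl.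
by rewrite ptensPr; exact: tmulPr.
Qed.

Fact galois2_bilinear : bilinear_for *:%R *:%R galois2_fun.
Proof.
split=> [y a x x'|x a y y'] /=; rewrite /galois2_fun.
  by rewrite ptensPl; exact: tmulPl.
by rewrite linearP; exact: tmulPr.
Qed.

HB.instance Definition _ :=
  bilinear_isBilinear.Build k H H (H \ox H) _ _ galois1_fun galois1_bilinear.
HB.instance Definition _ :=
  bilinear_isBilinear.Build k H H (H \ox H) _ _ galois2_fun galois2_bilinear.

Definition T1 : {linear H \ox H -> H \ox H} := tlift galois1_fun.
Definition T2 : {linear H \ox H -> H \ox H} := tlift galois2_fun.

Lemma T1E x y : T1 (x \ot y) = Delta x * (1 \ot y).
Proof. exact: tliftE. Qed.

Lemma T2E x y : T2 (x \ot y) = (x \ot 1) * Delta y.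
Proof. exact: tliftE. Qed.

Definition antipode (eps : {linear H -> k^o}) (S : {linear H -> H}) : Prop :=
  forall h, mulmap H (tmap S idfun (Delta h)) = (eps h)%:A /\
            mulmap H (tmap idfun S (Delta h)) = (eps h)%:A.

End Comodule.
End Hopf.

(* Main.v *)
Require Import Defs.
From HB Require Import structures.
From mathcomp Require Import all_boot all_algebra.
From mathcomp Require Import sesquilinear.

Set Implicit Arguments.
Unset Strict Implicit.
Unset Printing Implicit Defensive.

Import GRing.Theory.
Local Open Scope ring_scope.

(** The antipode is the convolution inverse of the identity, so each of the
    other conditions has to be matched with the invertibility of the identity
    in [Hom(H, H)].

    For the Galois maps, the point is that [Hom(H, H)] under convolution is
    isomorphic to the algebra of right module, left comodule endomorphisms of
    [H \ox H]: a map [f] corresponds to [x \ot y |-> sum x_1 \ot f(x_2) y], and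
    an endomorphism [F] to [x |-> (eps \ot id)(F (x \ot 1))] (lemmas
    [lgalois_surj], [lgalois_invK], [lgalois_conv]).  The map [T1] corresponds
    to the identity, so it has an inverse among the module and comodule maps if
    and only if the identity has a convolution inverse.  The maps
    [x \ot y |-> sum x f(y_1) \ot y_2] give in the same way an anti-isomorphism
    that sends the identity to [T2].

    For the regular representations, composition with an algebra morphism
    [phi : A -> B] preserves convolution, so it sends inverses to inverses.
    Conversely, let [G] be an inverse of [phi o f].  If [phi] has a retraction
    [rho] that is linear over [A] on one side, then [rho o G] is a one-sided
    inverse of [f]; its image [phi o rho o G] is a one-sided inverse of
    [phi o f], hence equal to [G], and since [phi] is injective, [rho o G] is
    inverse to [f] on both sides (lemmas [conv_inverse_retraction_l] and
    [conv_inverse_retraction_r]).  For left and right multiplication operators,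
    [rho] is evaluation at [1]. *)

(* Each of these maps is a lift of a bilinear map; unification must not compare
   two different ones by unfolding them. *)
#[local] Opaque tmap tassoc tassocV tunitl tunitr mulmap.

(** * Naturality of tensor maps *)

Section TensorNaturality.
Context (k : fieldType).

Lemma tmap_comp (U U' U'' V V' V'' : lmodType k)
    (f : {linear U -> U'}) (f' : {linear U' -> U''})
    (g : {linear V -> V'}) (g' : {linear V' -> V''}) t :
  tmap f' g' (tmap f g t) = tmap (f' \o f) (g' \o g) t.
Proof.
apply: (tens_ext (f := tmap f' g' \o tmap f g)) => u v.
by rewrite /= !tmapE.
Qed.

Lemma eq_tmap (U U' V V' : lmodType k) (f f' : {linear U -> U'})
    (g g' : {linear V -> V'}) : f =1 f' -> g =1 g' -> tmap f g =1 tmap f' g'.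
Proof. by move=> /linear_eq-> /linear_eq->. Qed.

Lemma tmap_id (U V : lmodType k) (t : U \ox V) : tmap idfun idfun t = t.
Proof.
by apply: (tens_ext (f := tmap idfun idfun) (g := idfun)) => u v; rewrite tmapE.
Qed.

Lemma tassoc_nat (U U' V V' W W' : lmodType k) (f : {linear U -> U'})
    (g : {linear V -> V'}) (h : {linear W -> W'}) t :
  tassoc _ _ _ (tmap (tmap f g) h t) = tmap f (tmap g h) (tassoc _ _ _ t).
Proof.
elim/tens_ind: t => [s w||s t Es Et|a t Et].
- elim/tens_ind: s => [u v||s t Es Et|a t Et].
  + by rewrite !tmapE !tassocE !tmapE.
  + by rewrite !(linear0, linear0l).
  + by rewrite !(linearD, linearDl) Es Et.
  + by rewrite !(linearZ, linearZl_LR) /= Et.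
- by rewrite !linear0.
- by rewrite !linearD Es Et.
- by rewrite !linearZ /= Et.
Qed.

Lemma tassocV_nat (U U' V V' W W' : lmodType k) (f : {linear U -> U'})
    (g : {linear V -> V'}) (h : {linear W -> W'}) t :
  tassocV _ _ _ (tmap f (tmap g h) t) = tmap (tmap f g) h (tassocV _ _ _ t).
Proof.
elim/tens_ind: t => [u s||s t Es Et|a t Et].
- elim/tens_ind: s => [v w||s t Es Et|a t Et].
  + by rewrite !tmapE !tassocVE !tmapE.
  + by rewrite !(linear0, linear0r).
  + by rewrite !(linearD, linearDr) Es Et.
  + by rewrite !(linearZ, linearZr_LR) /= Et.
- by rewrite !linear0.
- by rewrite !linearD Es Et.
- by rewrite !linearZ /= Et.
Qed.

Lemma tassocK (U V W : lmodType k) : cancel (tassoc U V W) (tassocV U V W).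
Proof.
move=> t; elim/tens_ind: t => [s w||s t Es Et|a t Et].
- elim/tens_ind: s => [u v||s t Es Et|a t Et].
  + by rewrite tassocE tassocVE.
  + by rewrite !(linear0, linear0l).
  + by rewrite !(linearD, linearDl) Es Et.
  + by rewrite !(linearZ, linearZl_LR) /= Et.
- by rewrite !linear0.
- by rewrite !linearD Es Et.
- by rewrite !linearZ /= Et.
Qed.

(** In [(id \ot F) (sum x_1 \ot (x_2 \ot w))] the last argument of [F] stays
    fixed, so the expression is a linear map [id \ot G] applied to the coproduct
    of [x], where the coalgebra axioms can act. *)
Lemma tmap_tassoc_slice (U V W X : lmodType k) (F : {linear V \ox W -> X})
    (G : {linear V -> X}) w :
    (forall v, F (v \ot w) = G v) ->
  forall t : U \ox V, tmap idfun F (tassoc _ _ _ (t \ot w)) = tmap idfun G t.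
Proof.
move=> FG; elim/tens_ind=> [u v||s t Es Et|a t Et].
- by rewrite tassocE !tmapE FG.
- by rewrite linear0l !linear0.
- by rewrite linearDl !linearD Es Et.
- by rewrite linearZl_LR !linearZ /= Et.
Qed.

Lemma tmap_tassocV_slice (U V W X : lmodType k) (F : {linear U \ox V -> X})
    (G : {linear V -> X}) u :
    (forall v, F (u \ot v) = G v) ->
  forall t : V \ox W, tmap F idfun (tassocV _ _ _ (u \ot t)) = tmap G idfun t.
Proof.
move=> FG; elim/tens_ind=> [v w||s t Es Et|a t Et].
- by rewrite tassocVE !tmapE FG.
- by rewrite linear0r !linear0.
- by rewrite linearDr !linearD Es Et.
- by rewrite linearZr_LR !linearZ /= Et.
Qed.

Lemma mulmap_assoc (A : algType k) t :
  mulmap A (tmap idfun (mulmap A) (tassoc _ _ _ t)) =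
  mulmap A (tmap (mulmap A) idfun t).
Proof.
elim/tens_ind: t => [s w||s t Es Et|a t Et].
- elim/tens_ind: s => [u v||s t Es Et|a t Et].
  + by rewrite tassocE !tmapE !mulmapE mulrA.
  + by rewrite !(linear0l, linear0).
  + by rewrite linearDl !linearD Es Et.
  + by rewrite linearZl_LR !linearZ /= Et.
- by rewrite !linear0.
- by rewrite !linearD Es Et.
- by rewrite !linearZ /= Et.
Qed.

End TensorNaturality.

(** * The convolution algebra *)

Section ConvolutionTheory.
Context (k : fieldType) (C : lmodType k).
Context (Delta : {linear C -> C \ox C}) (eps : {linear C -> k^o}).

Lemma convE (A : algType k) (f g : {linear C -> A}) x :
  conv Delta f g x = mulmap A (tmap f g (Delta x)).
Proof. by []. Qed.

Context (coalgC : coalgebra Delta eps).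

Lemma coassocV x :
  tassocV _ _ _ (tmap idfun Delta (Delta x)) = tmap Delta idfun (Delta x).
Proof.
by rewrite -(tassocK (tmap Delta idfun (Delta x))) (coassoc coalgC x).
Qed.

Section Monoid.
Context (A : algType k).
Implicit Types f g h : {linear C -> A}.

Lemma convA f g h :
  conv Delta f (conv Delta g h) = conv Delta (conv Delta f g) h.
Proof.
apply/linear_eq => x; rewrite !convE.
have -> : tmap f (conv Delta g h) (Delta x) =
    tmap idfun (mulmap A) (tmap f (tmap g h) (tmap idfun Delta (Delta x))).
  by rewrite !tmap_comp; apply: eq_tmap.
rewrite -(coassoc coalgC) -tassoc_nat mulmap_assoc !tmap_comp.
by congr (mulmap A _); apply: eq_tmap.
Qed.

Lemma conv_1l f : conv Delta (conv1 eps A) f = f.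
Proof.
apply/linear_eq => x; rewrite convE -[in RHS](counitl coalgC x).
apply: (tens_ext (f := mulmap A \o tmap _ _)
                 (g := f \o (tunitl C \o tmap eps idfun))) => u v.
by rewrite /= !tmapE mulmapE tunitlE linearZ /= mulr_algl.
Qed.

Lemma conv_1r f : conv Delta f (conv1 eps A) = f.
Proof.
apply/linear_eq => x; rewrite convE -[in RHS](counitr coalgC x).
apply: (tens_ext (f := mulmap A \o tmap _ _)
                 (g := f \o (tunitr C \o tmap idfun eps))) => u v.
by rewrite /= !tmapE mulmapE tunitrE linearZ /= mulr_algr.
Qed.

Lemma conv_left_right_inverse f g h :
  conv Delta g f = conv1 eps A -> conv Delta f h = conv1 eps A -> g = h.
Proof. by move=> gf fh; rewrite -[g]conv_1r -fh convA gf conv_1l. Qed.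

End Monoid.

(** * Convolution inverses and algebra morphisms *)

Section Pushforward.
Context (A B : algType k) (phi : {linear A -> B}).
Context (phiM : {morph phi : x y / x * y}) (phi1 : phi 1 = 1).
Implicit Types f g : {linear C -> A}.

Lemma comp_conv f g x :
  phi (conv Delta f g x) = conv Delta (phi \o f) (phi \o g) x.
Proof.
rewrite !convE.
apply: (tens_ext (f := phi \o (mulmap A \o tmap f g))
                 (g := mulmap B \o tmap _ _)) => u v.
by rewrite /= !tmapE !mulmapE phiM.
Qed.

Lemma comp_conv1 x : phi (conv1 eps A x) = conv1 eps B x.
Proof. by rewrite /= /conv1_fun linearZ /= phi1. Qed.

Lemma comp_conv_inverse f g :
  conv_inverse Delta eps f g -> conv_inverse Delta eps (phi \o f) (phi \o g).
Proof.
by case=> fg gf; split; apply/linear_eq => x;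
  rewrite -comp_conv ?fg ?gf comp_conv1.
Qed.

Section Retraction.
Context (rho : {linear B -> A}) (rho1 : rho 1 = 1).

Lemma retraction_conv1 x : rho (conv1 eps B x) = conv1 eps A x.
Proof. by rewrite /= /conv1_fun linearZ /= rho1. Qed.

(** Linearity of [rho] on the left recovers only the right inverse of [f]; that
    it is also a left inverse comes from the uniqueness of [G]. *)
Lemma conv_inverse_retraction_l f (G : {linear C -> B}) :
    (forall a b, rho (phi a * b) = a * rho b) ->
  conv_inverse Delta eps (phi \o f) G -> conv_inverse Delta eps (rho \o G) f.
Proof.
move=> rhoM [fG Gf].
have rhoK : cancel phi rho by move=> a; rewrite -[phi a]mulr1 rhoM rho1 mulr1.
have fS : conv Delta f (rho \o G) = conv1 eps A.
  apply/linear_eq => x; rewrite -retraction_conv1 -fG.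
  apply: (tens_ext (f := mulmap A \o tmap _ _)
                   (g := rho \o (mulmap B \o tmap (phi \o f) G))) => u v.
  by rewrite /= !tmapE !mulmapE rhoM.
have GE : G = phi \o (rho \o G).
  apply: conv_left_right_inverse Gf _.
  by apply/linear_eq => x; rewrite -comp_conv fS comp_conv1.
split=> //; apply/linear_eq => x; apply: (can_inj rhoK).
by rewrite comp_conv -GE Gf comp_conv1.
Qed.

(** The mirror image: linearity on the right recovers a left inverse first. *)
Lemma conv_inverse_retraction_r f (G : {linear C -> B}) :
    (forall a b, rho (b * phi a) = rho b * a) ->
  conv_inverse Delta eps (phi \o f) G -> conv_inverse Delta eps (rho \o G) f.
Proof.
move=> rhoM [fG Gf].
have rhoK : cancel phi rho by move=> a; rewrite -[phi a]mul1r rhoM rho1 mul1r.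
have Sf : conv Delta (rho \o G) f = conv1 eps A.
  apply/linear_eq => x; rewrite -retraction_conv1 -Gf.
  apply: (tens_ext (f := mulmap A \o tmap _ _)
                   (g := rho \o (mulmap B \o tmap G (phi \o f)))) => u v.
  by rewrite /= !tmapE !mulmapE rhoM.
have GE : (phi \o (rho \o G) : {linear C -> B}) = G.
  apply: conv_left_right_inverse fG.
  by apply/linear_eq => x; rewrite -comp_conv Sf comp_conv1.
split=> //; apply/linear_eq => x; apply: (can_inj rhoK).
by rewrite comp_conv GE fG comp_conv1.
Qed.

End Retraction.
End Pushforward.
End ConvolutionTheory.

(** * Convolution as composition of module and comodule maps *)

Section ConvolutionAction.
Context (k : fieldType) (C : lmodType k) (A : algType k).
Context (Delta : {linear C -> C \ox C}) (eps : {linear C -> k^o}).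
Implicit Types f g : {linear C -> A}.

Definition coact_l (M : lmodType k) : {linear C \ox M -> C \ox (C \ox M)} :=
  tassoc C C M \o tmap Delta idfun.
Definition coact_r (M : lmodType k) : {linear M \ox C -> (M \ox C) \ox C} :=
  tassocV M C C \o tmap idfun Delta.

Definition right_linear (F : {linear C \ox A -> C \ox A}) : Prop :=
  forall t a, F (tmap idfun (rmul a) t) = tmap idfun (rmul a) (F t).
Definition left_linear (F : {linear A \ox C -> A \ox C}) : Prop :=
  forall a t, F (tmap (lmul a) idfun t) = tmap (lmul a) idfun (F t).
Definition left_colinear (F : {linear C \ox A -> C \ox A}) : Prop :=
  forall t, coact_l A (F t) = tmap idfun F (coact_l A t).
Definition right_colinear (F : {linear A \ox C -> A \ox C}) : Prop :=
  forall t, coact_r A (F t) = tmap F idfun (coact_r A t).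

Definition tens1r (x : C) : C \ox A := x \ot 1.
Definition tens1l (y : C) : A \ox C := 1 \ot y.

Fact tens1r_linear : linear tens1r.
Proof. by move=> a x y; rewrite /tens1r ptensPl. Qed.
Fact tens1l_linear : linear tens1l.
Proof. by move=> a x y; rewrite /tens1l ptensPr. Qed.

HB.instance Definition _ :=
  GRing.isLinear.Build k C (C \ox A) _ tens1r tens1r_linear.
HB.instance Definition _ :=
  GRing.isLinear.Build k C (A \ox C) _ tens1l tens1l_linear.

Definition counit_left : {linear C \ox A -> A} := tunitl A \o tmap eps idfun.
Definition counit_right : {linear A \ox C -> A} := tunitr A \o tmap idfun eps.

(** In Sweedler notation, [lgalois f] is [x \ot y |-> sum x_1 \ot f(x_2) y] and
    [rgalois f] is [x \ot y |-> sum x f(y_1) \ot y_2]. *)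
Definition lgalois f : {linear C \ox A -> C \ox A} :=
  tmap idfun (mulmap A \o tmap f idfun) \o coact_l A.
Definition rgalois f : {linear A \ox C -> A \ox C} :=
  tmap (mulmap A \o tmap idfun f) idfun \o coact_r A.

Definition lgalois_inv (F : {linear C \ox A -> C \ox A}) : {linear C -> A} :=
  counit_left \o (F \o tens1r).
Definition rgalois_inv (F : {linear A \ox C -> A \ox C}) : {linear C -> A} :=
  counit_right \o (F \o tens1l).

Lemma coact_lE (M : lmodType k) x (y : M) :
  coact_l M (x \ot y) = tassoc _ _ _ (Delta x \ot y).
Proof. by rewrite /= tmapE. Qed.

Lemma coact_rE (M : lmodType k) (x : M) y :
  coact_r M (x \ot y) = tassocV _ _ _ (x \ot Delta y).
Proof. by rewrite /= tmapE. Qed.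

Lemma lgaloisE f x y : lgalois f (x \ot y) = tmap idfun (rmul y \o f) (Delta x).
Proof.
rewrite -[LHS]/(tmap _ _ (coact_l A (x \ot y))) coact_lE.
by apply: tmap_tassoc_slice => v; rewrite /= tmapE mulmapE.
Qed.

Lemma rgaloisE f x y : rgalois f (x \ot y) = tmap (lmul x \o f) idfun (Delta y).
Proof.
rewrite -[LHS]/(tmap _ _ (coact_r A (x \ot y))) coact_rE.
by apply: tmap_tassocV_slice => v; rewrite /= tmapE mulmapE.
Qed.

Lemma lgalois_right_linear f : right_linear (lgalois f).
Proof.
move=> t a.
apply: (tens_ext (f := lgalois f \o tmap idfun (rmul a))
                 (g := tmap idfun (rmul a) \o lgalois f)) => x y.
rewrite -[LHS]/(lgalois f (tmap idfun (rmul a) (x \ot y))) tmapE.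
rewrite -[RHS]/(tmap _ _ (lgalois f (x \ot y))) !lgaloisE tmap_comp.
by apply: eq_tmap => z //; rewrite /= /rmul mulrA.
Qed.

Lemma rgalois_left_linear f : left_linear (rgalois f).
Proof.
move=> a t.
apply: (tens_ext (f := rgalois f \o tmap (lmul a) idfun)
                 (g := tmap (lmul a) idfun \o rgalois f)) => x y.
rewrite -[LHS]/(rgalois f (tmap (lmul a) idfun (x \ot y))) tmapE.
rewrite -[RHS]/(tmap _ _ (rgalois f (x \ot y))) !rgaloisE tmap_comp.
by apply: eq_tmap => z //; rewrite /= /lmul mulrA.
Qed.

Context (coalgC : coalgebra Delta eps).

(** Both sides send [x \ot y] to [sum x_1 \ot (x_2 \ot f(x_3) y)], bracketed in
    the two ways that coassociativity identifies. *)
Lemma lgalois_left_colinear f : left_colinear (lgalois f).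
Proof.
apply: (tens_ext (f := coact_l A \o lgalois f)
                 (g := tmap idfun (lgalois f) \o coact_l A)) => x y.
rewrite -[LHS]/(coact_l A (lgalois f (x \ot y))) lgaloisE.
rewrite -[RHS]/(tmap _ _ (coact_l A (x \ot y))) coact_lE.
rewrite (tmap_tassoc_slice (G := tmap idfun (rmul y \o f) \o Delta));
  last by move=> v; rewrite lgaloisE.
rewrite -[LHS]/(tassoc _ _ _ (tmap Delta idfun _)) tmap_comp.
transitivity (tmap idfun (tmap idfun (rmul y \o f))
                (tassoc _ _ _ (tmap Delta idfun (Delta x)))).
  rewrite -tassoc_nat tmap_comp; congr (tassoc _ _ _ _).
  by apply: eq_tmap => z //; rewrite /= tmap_id.
by rewrite (coassoc coalgC x) tmap_comp; apply: eq_tmap.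
Qed.

Lemma rgalois_right_colinear f : right_colinear (rgalois f).
Proof.
apply: (tens_ext (f := coact_r A \o rgalois f)
                 (g := tmap (rgalois f) idfun \o coact_r A)) => x y.
rewrite -[LHS]/(coact_r A (rgalois f (x \ot y))) rgaloisE.
rewrite -[RHS]/(tmap _ _ (coact_r A (x \ot y))) coact_rE.
rewrite (tmap_tassocV_slice (G := tmap (lmul x \o f) idfun \o Delta));
  last by move=> v; rewrite rgaloisE.
rewrite -[LHS]/(tassocV _ _ _ (tmap idfun Delta _)) tmap_comp.
transitivity (tmap (tmap (lmul x \o f) idfun) idfun
                (tassocV _ _ _ (tmap idfun Delta (Delta y)))).
  rewrite -tassocV_nat tmap_comp; congr (tassocV _ _ _ _).
  by apply: eq_tmap => z //; rewrite /= tmap_id.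
by rewrite (coassocV coalgC y) tmap_comp; apply: eq_tmap.
Qed.

(** Applying the counit to the middle factor undoes the coaction, so a comodule
    map can be recovered from its composite with the counit. *)
Lemma coact_l_counit t : tmap idfun (counit_left) (coact_l A t) = t.
Proof.
apply: (tens_ext (f := tmap idfun (counit_left) \o coact_l A)
                 (g := idfun)) => x y.
rewrite -[LHS]/(tmap _ _ (coact_l A (x \ot y))) coact_lE /=.
rewrite -[in RHS](counitr coalgC x).
elim/tens_ind: (Delta x) => [u v||s t' Es Et|a t' Et].
- by rewrite tassocE !tmapE /= tmapE tunitlE tunitrE linearZl_LR linearZr_LR.
- by rewrite !(linear0l, linear0).
- by rewrite !(linearDl, linearD) /= Es Et.
- by rewrite !(linearZl_LR, linearZ) /= Et.
Qed.

Lemma coact_r_counit t : tmap (counit_right) idfun (coact_r A t) = t.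
Proof.
apply: (tens_ext (f := tmap (counit_right) idfun \o coact_r A)
                 (g := idfun)) => x y.
rewrite -[LHS]/(tmap _ _ (coact_r A (x \ot y))) coact_rE /=.
rewrite -[in RHS](counitl coalgC y).
elim/tens_ind: (Delta y) => [u v||s t' Es Et|a t' Et].
- by rewrite tassocVE !tmapE /= tmapE tunitlE tunitrE linearZl_LR linearZr_LR.
- by rewrite !(linear0r, linear0).
- by rewrite !(linearDr, linearD) /= Es Et.
- by rewrite !(linearZr_LR, linearZ) /= Et.
Qed.

(** A right module map is determined by its values at [x \ot 1], and a left
    comodule map [F] has [F t = (id \ot (eps \ot id) F)(rho t)] where [rho] is
    the coaction; at [t = x \ot 1] this is [sum x_1 \ot f(x_2)] with
    [f = lgalois_inv F]. *)
Lemma lgalois_surj (F : {linear C \ox A -> C \ox A}) :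
  right_linear F -> left_colinear F -> F =1 lgalois (lgalois_inv F).
Proof.
move=> Fmod Fcomod; apply: tens_ext => x y.
have -> : x \ot y = tmap idfun (rmul y) (x \ot 1).
  by rewrite tmapE /= /rmul mul1r.
rewrite Fmod lgalois_right_linear; congr (tmap _ _ _).
rewrite -[LHS]coact_l_counit Fcomod coact_lE tmap_comp lgaloisE.
by apply: tmap_tassoc_slice => v; rewrite /= /rmul mulr1.
Qed.

Lemma rgalois_surj (F : {linear A \ox C -> A \ox C}) :
  left_linear F -> right_colinear F -> F =1 rgalois (rgalois_inv F).
Proof.
move=> Fmod Fcomod; apply: tens_ext => x y.
have -> : x \ot y = tmap (lmul x) idfun (1 \ot y).
  by rewrite tmapE /= /lmul mulr1.
rewrite Fmod rgalois_left_linear; congr (tmap _ _ _).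
rewrite -[LHS]coact_r_counit Fcomod coact_rE tmap_comp rgaloisE.
by apply: tmap_tassocV_slice => v; rewrite /= /lmul mul1r.
Qed.

Lemma counit_lgalois f t :
  counit_left (lgalois f t) = mulmap A (tmap f idfun t).
Proof.
apply: (tens_ext (f := counit_left \o lgalois f)
                 (g := mulmap A \o tmap f idfun)) => x y.
rewrite -[LHS]/(counit_left (lgalois f (x \ot y))) lgaloisE.
rewrite /= tmapE mulmapE -[in RHS](counitl coalgC x).
apply: (tens_ext (f := counit_left \o tmap idfun (rmul y \o f))
  (g := rmul y \o (f \o (tunitl C \o tmap eps idfun)))) => u v.
by rewrite /= !tmapE /= !tunitlE !linearZ.
Qed.

Lemma counit_rgalois f t :
  counit_right (rgalois f t) = mulmap A (tmap idfun f t).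
Proof.
apply: (tens_ext (f := counit_right \o rgalois f)
                 (g := mulmap A \o tmap idfun f)) => x y.
rewrite -[LHS]/(counit_right (rgalois f (x \ot y))) rgaloisE.
rewrite /= tmapE mulmapE -[in RHS](counitr coalgC y).
apply: (tens_ext (f := counit_right \o tmap (lmul x \o f) idfun)
  (g := lmul x \o (f \o (tunitr C \o tmap idfun eps)))) => u v.
by rewrite /= !tmapE /= !tunitrE !linearZ.
Qed.

Lemma lgalois_invK f : lgalois_inv (lgalois f) =1 f.
Proof.
move=> x; rewrite -[LHS]/(counit_left (lgalois f (x \ot 1))).
by rewrite counit_lgalois tmapE mulmapE mulr1.
Qed.

Lemma rgalois_invK f : rgalois_inv (rgalois f) =1 f.
Proof.
move=> x; rewrite -[LHS]/(counit_right (rgalois f (1 \ot x))).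
by rewrite counit_rgalois tmapE mulmapE mul1r.
Qed.

Lemma lgalois_inj f g : lgalois f =1 lgalois g -> f = g.
Proof.
move=> /linear_eq fg; apply/linear_eq => x.
by rewrite -[LHS]lgalois_invK fg lgalois_invK.
Qed.

Lemma rgalois_inj f g : rgalois f =1 rgalois g -> f = g.
Proof.
move=> /linear_eq fg; apply/linear_eq => x.
by rewrite -[LHS]rgalois_invK fg rgalois_invK.
Qed.

(** The composite is again a module and comodule map, so it equals [lgalois h]
    for some [h], which [counit_lgalois] identifies as the convolution. *)
Lemma lgalois_conv f g t : lgalois (conv Delta f g) t = lgalois f (lgalois g t).
Proof.
pose F : {linear C \ox A -> C \ox A} := lgalois f \o lgalois g.
have Fmod : right_linear F.
  move=> s a; rewrite -[LHS]/(lgalois f (lgalois g _)).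
  by rewrite !lgalois_right_linear.
have Fcomod : left_colinear F.
  move=> s; rewrite [LHS]lgalois_left_colinear lgalois_left_colinear.
  by rewrite tmap_comp.
rewrite -[RHS]/(F t) (lgalois_surj Fmod Fcomod).
congr (lgalois _ t); apply/linear_eq => x.
rewrite -[RHS]/(counit_left (lgalois f (lgalois g (x \ot 1)))).
rewrite counit_lgalois lgaloisE tmap_comp convE.
by congr (mulmap A _); apply: eq_tmap => z //; rewrite /= /rmul mulr1.
Qed.

(** The factors come out in reverse order, since the inner map has already put
    [g(y_1)] to the left of [f(y_2)]. *)
Lemma rgalois_conv f g t : rgalois (conv Delta g f) t = rgalois f (rgalois g t).
Proof.
pose F : {linear A \ox C -> A \ox C} := rgalois f \o rgalois g.
have Fmod : left_linear F.
  move=> a s; rewrite -[LHS]/(rgalois f (rgalois g _)).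
  by rewrite !rgalois_left_linear.
have Fcomod : right_colinear F.
  move=> s; rewrite [LHS]rgalois_right_colinear rgalois_right_colinear.
  by rewrite tmap_comp.
rewrite -[RHS]/(F t) (rgalois_surj Fmod Fcomod).
congr (rgalois _ t); apply/linear_eq => x.
rewrite -[RHS]/(counit_right (rgalois f (rgalois g (1 \ot x)))).
rewrite counit_rgalois rgaloisE tmap_comp convE.
by congr (mulmap A _); apply: eq_tmap => z //; rewrite /= /lmul mul1r.
Qed.

Lemma lgalois_conv1 : lgalois (conv1 eps A) =1 id.
Proof.
have id_mod : right_linear (idfun : {linear C \ox A -> C \ox A}) by [].
have id_comod : left_colinear (idfun : {linear C \ox A -> C \ox A}).
  by move=> t; rewrite tmap_id.
move=> t; rewrite -[RHS]/(idfun t) (lgalois_surj id_mod id_comod).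
congr (lgalois _ t); apply/linear_eq => x.
by rewrite /= tmapE tunitlE.
Qed.

Lemma rgalois_conv1 : rgalois (conv1 eps A) =1 id.
Proof.
have id_mod : left_linear (idfun : {linear A \ox C -> A \ox C}) by [].
have id_comod : right_colinear (idfun : {linear A \ox C -> A \ox C}).
  by move=> t; rewrite tmap_id.
move=> t; rewrite -[RHS]/(idfun t) (rgalois_surj id_mod id_comod).
congr (rgalois _ t); apply/linear_eq => x.
by rewrite /= tmapE tunitrE.
Qed.

End ConvolutionAction.

(** * Galois maps *)

Section Galois.
Context (k : fieldType) (H : algType k).
Context (Delta : {linear H -> H \ox H}) (eps : {linear H -> k^o}).
Context (coalgH : coalgebra Delta eps).

Lemma T1_lgalois : T1 Delta =1 lgalois Delta (idfun : {linear H -> H}).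
Proof.
apply: tens_ext => x y; rewrite T1E lgaloisE.
elim/tens_ind: (Delta x) => [u v||s t Es Et|a t Et].
- by rewrite tensM tmapE mulr1.
- by rewrite mul0r linear0.
- by rewrite mulrDl linearD Es Et.
- by rewrite linearZ /= -Et; exact: tmulZl.
Qed.

Lemma T2_rgalois : T2 Delta =1 rgalois Delta (idfun : {linear H -> H}).
Proof.
apply: tens_ext => x y; rewrite T2E rgaloisE.
elim/tens_ind: (Delta y) => [u v||s t Es Et|a t Et].
- by rewrite tensM tmapE mul1r.
- by rewrite mulr0 linear0.
- by rewrite mulrDr linearD Es Et.
- by rewrite linearZ /= -Et; exact: tmulZr.
Qed.

Lemma conv_inverse_T1 (S : {linear H -> H}) :
    conv_inverse Delta eps S (idfun : {linear H -> H}) ->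
  [/\ cancel (T1 Delta) (lgalois Delta S), cancel (lgalois Delta S) (T1 Delta),
      rmodule_map (lgalois Delta S) & lcomodule_map Delta (lgalois Delta S)].
Proof.
case=> [SI IS]; split.
- move=> t; rewrite T1_lgalois.
  by rewrite -(lgalois_conv coalgH) SI (lgalois_conv1 coalgH).
- move=> t; rewrite T1_lgalois.
  by rewrite -(lgalois_conv coalgH) IS (lgalois_conv1 coalgH).
- exact: lgalois_right_linear.
- exact: (lgalois_left_colinear coalgH).
Qed.

Lemma conv_inverse_T2 (S : {linear H -> H}) :
    conv_inverse Delta eps S (idfun : {linear H -> H}) ->
  [/\ cancel (T2 Delta) (rgalois Delta S), cancel (rgalois Delta S) (T2 Delta),
      lmodule_map (rgalois Delta S) & rcomodule_map Delta (rgalois Delta S)].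
Proof.
case=> [SI IS]; split.
- move=> t; rewrite T2_rgalois.
  by rewrite -(rgalois_conv coalgH) IS (rgalois_conv1 coalgH).
- move=> t; rewrite T2_rgalois.
  by rewrite -(rgalois_conv coalgH) SI (rgalois_conv1 coalgH).
- exact: rgalois_left_linear.
- exact: (rgalois_right_colinear coalgH).
Qed.

Lemma T1_conv_inverse (F : {linear H \ox H -> H \ox H}) :
    cancel (T1 Delta) F -> cancel F (T1 Delta) ->
    rmodule_map F -> lcomodule_map Delta F ->
  conv_inverse Delta eps (lgalois_inv eps F) (idfun : {linear H -> H}).
Proof.
move=> T1K FK Fmod Fcomod; have FE := lgalois_surj coalgH Fmod Fcomod.
split; apply: (lgalois_inj coalgH) => t;
  rewrite (lgalois_conv coalgH) (lgalois_conv1 coalgH).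
  by rewrite -FE -T1_lgalois T1K.
by rewrite -FE -T1_lgalois FK.
Qed.

Lemma T2_conv_inverse (F : {linear H \ox H -> H \ox H}) :
    cancel (T2 Delta) F -> cancel F (T2 Delta) ->
    lmodule_map F -> rcomodule_map Delta F ->
  conv_inverse Delta eps (rgalois_inv eps F) (idfun : {linear H -> H}).
Proof.
move=> T2K FK Fmod Fcomod; have FE := rgalois_surj coalgH Fmod Fcomod.
split; apply: (rgalois_inj coalgH) => t;
  rewrite (rgalois_conv coalgH) (rgalois_conv1 coalgH).
  by rewrite -FE -T2_rgalois FK.
by rewrite -FE -T2_rgalois T2K.
Qed.

End Galois.

(** * Regular representations *)

Section RegularRepresentations.
Context (k : fieldType) (H : algType k).

(** In [End H] the product [L_a F] evaluates at [1] to [a (F 1)]; in its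
    converse [R_a] is applied last in [F R_a], which evaluates to [(F 1) a].
    Hence evaluation is left linear in the first case and right linear in the
    second. *)
Definition end_eval1 (F : End H) : H := F 1.
Definition cend_eval1 (F : (End H)^c) : H := (F : End H) 1.

Fact end_eval1_linear : linear end_eval1. Proof. by []. Qed.
Fact cend_eval1_linear : linear cend_eval1. Proof. by []. Qed.

HB.instance Definition _ :=
  GRing.isLinear.Build k (End H) H _ end_eval1 end_eval1_linear.
HB.instance Definition _ :=
  GRing.isLinear.Build k (End H)^c H _ cend_eval1 cend_eval1_linear.

Lemma Lreg1 : Lreg H 1 = 1.
Proof. by apply/linear_eq => x; rewrite /= /lmul mul1r. Qed.

Lemma Rreg1 : Rreg H 1 = 1.
Proof. by apply/linear_eq => x; rewrite /= /rmul mulr1. Qed.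

Lemma comp_idfun (U V : lmodType k) (f : {linear U -> V}) :
  (f \o (idfun : {linear U -> U}) : {linear U -> V}) = f.
Proof. exact/linear_eq. Qed.

Context (Delta : {linear H -> H \ox H}) (eps : {linear H -> k^o}).
Context (coalgH : coalgebra Delta eps).

Lemma conv_inverse_Lreg (S : {linear H -> H}) :
    conv_inverse Delta eps S (idfun : {linear H -> H}) ->
  conv_invertible Delta eps (Lreg H).
Proof.
move=> /(comp_conv_inverse (@LregM k H) Lreg1); rewrite comp_idfun => -[SI IS].
by exists (Lreg H \o S).
Qed.

Lemma conv_inverse_Rreg (S : {linear H -> H}) :
    conv_inverse Delta eps S (idfun : {linear H -> H}) ->
  conv_invertible Delta eps (Rreg H).
Proof.
move=> /(comp_conv_inverse (@RregM k H) Rreg1); rewrite comp_idfun => -[SI IS].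
by exists (Rreg H \o S).
Qed.

Lemma Lreg_conv_inverse (G : {linear H -> End H}) :
    conv_inverse Delta eps (Lreg H) G ->
  conv_inverse Delta eps (end_eval1 \o G) (idfun : {linear H -> H}).
Proof.
rewrite -{1}[Lreg H]comp_idfun.
exact: (conv_inverse_retraction_l coalgH (@LregM k H) Lreg1).
Qed.

Lemma Rreg_conv_inverse (G : {linear H -> (End H)^c}) :
    conv_inverse Delta eps (Rreg H) G ->
  conv_inverse Delta eps (cend_eval1 \o G) (idfun : {linear H -> H}).
Proof.
rewrite -{1}[Rreg H]comp_idfun.
exact: (conv_inverse_retraction_r coalgH (@RregM k H) Rreg1).
Qed.

End RegularRepresentations.

Lemma antipode_conv_inverse (k : fieldType) (H : algType k)
    (Delta : {linear H -> H \ox H}) (eps : {linear H -> k^o})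
    (S : {linear H -> H}) :
  antipode Delta eps S <->
  conv_inverse Delta eps S (idfun : {linear H -> H}).
Proof.
split=> [aS|[Sl Sr] h]; first by split; apply/linear_eq => h; have [] := aS h.
split; first exact: (congr1 (fun F : {linear H -> H} => F h) Sl).
exact: (congr1 (fun F : {linear H -> H} => F h) Sr).
Qed.

Theorem theorem3p1 (k : fieldType) (H : algType k)
    (Delta : {linear H -> H \ox H}) (eps : {linear H -> k^o}) :
  bialgebra Delta eps ->
  [<->
    (exists S : {linear H -> H}, antipode Delta eps S);
    (exists S : {linear H -> H},
       conv_inverse Delta eps S (idfun : {linear H -> H}));
    (exists T1inv : {linear H \ox H -> H \ox H},
       [/\ cancel (T1 Delta) T1inv, cancel T1inv (T1 Delta),
           rmodule_map T1inv & lcomodule_map Delta T1inv]);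
    (exists T2inv : {linear H \ox H -> H \ox H},
       [/\ cancel (T2 Delta) T2inv, cancel T2inv (T2 Delta),
           lmodule_map T2inv & rcomodule_map Delta T2inv]);
    conv_invertible Delta eps (Lreg H);
    conv_invertible Delta eps (Rreg H)].
Proof.
move=> /bialgebra_coalgebra coalgH; tfae.
- by case=> S /antipode_conv_inverse SI; exists S.
- by case=> S SI; exists (lgalois Delta S); exact: (conv_inverse_T1 coalgH SI).
- case=> F [T1K FK Fmod Fcomod].
  have SI := T1_conv_inverse coalgH T1K FK Fmod Fcomod.
  by eexists; exact: (conv_inverse_T2 coalgH SI).
- case=> F [T2K FK Fmod Fcomod].
  exact/conv_inverse_Lreg/(T2_conv_inverse coalgH T2K FK Fmod Fcomod).
- by case=> G /(Lreg_conv_inverse coalgH) /conv_inverse_Rreg.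
- case=> G /(Rreg_conv_inverse coalgH) SI.
  by exists (@cend_eval1 k H \o G); apply/antipode_conv_inverse.
Qed.
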